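(* Let $d\ge 2$ be an integer, let $V=\{1,\dots,d\}$, and let $\Pi=(\pi_{ij})$ be a real $d\times d$ matrix such that: $\pi_{ii}=1$ for all $i\in V$; $\pi_{ij}>0$ for all $i,j\in V$; $\pi_{ij}\le \pi_{ik}\pi_{kj}$ for all $i,j,k\in V$; and there exist $i,j,k\in V$ with $\pi_{ij}<\pi_{ik}\pi_{kj}$. Let $K_d^+$ be the dual cone of the solvency cone $K_d$ induced by $\Pi$. Then $K_d^+$ has at most $\sum_{p=1}^{d-1}\binom{d-2}{p-1}\binom{d}{p}$ extreme directions.
   Context: The solvency cone is $K_d=\{\sum_{(i,j)\in V\times V} z_{ij}(\pi_{ij}e^i-e^j) : z_{ij}\ge 0 \text{ for all } i,j\}$, where $e^i$ is the $i$-th unit vector of $\mathbb{R}^d$, and $K_d^+=\{y\in\mathbb{R}^d : x^\top y\ge 0 \text{ for all } x\in K_d\}$. A vector $y\in K\setminus\{0\}$ is an extreme direction of a polyhedral convex cone $K$ if it belongs to a $1$-dimensional face of $K$; extreme directions that are positive multiples of each other are considered identical (and counted once). *)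

(* Defs.v *)
(* [R : realType] models the reals; vectors of R^d are column vectors,
   indexed from 0 by ['I_d]. *)
From HB Require Import structures.
From mathcomp Require Import all_boot all_order all_algebra.
From mathcomp Require Import all_classical all_reals.

Set Implicit Arguments.
Unset Strict Implicit.
Unset Printing Implicit Defensive.

Import Order.TTheory GRing.Theory Num.Theory.

Local Open Scope classical_set_scope.
Local Open Scope ring_scope.

Section Cones.
Context {R : realType} {d : nat}.
Implicit Types (K F : set 'cV[R]_d) (x y : 'cV[R]_d).

Definition dot x y : R := (x^T *m y) 0 0.

Definition unit_vec (i : 'I_d) : 'cV[R]_d := delta_mx i 0.

Definition solvency_cone (P : 'M[R]_d) : set 'cV[R]_d :=
  [set x | exists2 z : 'M[R]_d, (forall i j, 0 <= z i j) &
     x = \sum_i \sum_j z i j *: (P i j *: unit_vec i - unit_vec j)].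

Definition dual_cone K : set 'cV[R]_d :=
  [set y | forall x, K x -> 0 <= dot x y].

(* Faces in the sense of polyhedral theory: loci where a valid linear
   inequality is tight.  [K] itself and the empty set are faces. *)
Definition is_face K F : Prop :=
  exists (a : 'cV[R]_d) (c : R),
    (forall x, K x -> c <= dot a x) /\ F = [set x | K x /\ dot a x = c].

Definition affine_hull F : set 'cV[R]_d :=
  [set x | exists (n : nat) (p : 'I_n -> 'cV[R]_d) (c : 'I_n -> R),
     [/\ forall i, F (p i), \sum_i c i = 1 & x = \sum_i c i *: p i]].

(* The dimension of a nonempty set is that of the direction space of its
   affine hull; the empty set has no dimension. *)
Definition has_dim F (k : nat) : Prop :=
  exists (x0 : 'cV[R]_d) (U : {vspace 'cV[R]_d}),
    \dim U = k /\ affine_hull F = [set x | x - x0 \in U].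

Definition extreme_direction K : set 'cV[R]_d :=
  [set y | [/\ K y, y != 0 & exists F, [/\ is_face K F, has_dim F 1 & F y]]].

Definition open_ray y : set 'cV[R]_d := [set t *: y | t in [set t : R | 0 < t]].

(* Extreme directions up to positive multiples: two vectors are identified
   exactly when they span the same open ray. *)
Definition extreme_rays K : set (set 'cV[R]_d) :=
  [set open_ray y | y in extreme_direction K].

End Cones.

(* Main.v *)
Require Import Defs.
From HB Require Import structures.
From mathcomp Require Import all_boot all_order all_algebra.
From mathcomp Require Import all_classical all_reals.
From mathcomp Require Import zify ring lra.

(** The dual cone is cut out by the inequalities y_j <= P_ij y_i, and the
    strict triangle inequality forces all its nonzero elements to be positive
    ([dual_solvency_cone_gt0]).  For such a y write i -> j when
    P_ij y_i = y_j.  The triangle inequality makes this tightness relation a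
    preorder.  If y is an extreme direction, the preorder is connected as an
    undirected graph: otherwise scaling one component of y slightly up or down
    stays in the cone, and the face of y is not a line ([tight_connected]).

    A minimal set S of sources from which everything is reached is an
    antichain, and the tight pairs going from S to its complement still form a
    connected graph ([crossing_connected]).  This graph is bipartite; choose
    in it a spanning tree rooted at a vertex outside S, and let b(s) be
    the number of children of s.  The b(s) form a composition of d - |S| - 1
    into |S| parts, so there are at most binom(d-2, |S|-1) of them, and
    summing over S gives the bound ([card_codes]).

    It remains to see that S and b determine the ray of y.  Suppose y and y'
    have the same S and b, and let W be the set where y'/y is maximal.  Tight
    pairs of y' starting in W end in W, and tight pairs of y ending in W start
    in W.  Let A be the part of W in S.  The edges of a tree that meet A
    number |A| plus the sum of b over A, hence equally many in both trees.  In
    the tree of y' they all lie inside W, so they are fewer than |W|.  In the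
    tree of y the remaining edges lie inside the complement of W; if that is
    nonempty they are fewer than d - |W|, which leaves at least |W| edges
    meeting A.  This contradiction shows that y'/y is constant
    ([branching_rigid]). *)

Set Implicit Arguments.
Unset Strict Implicit.
Unset Printing Implicit Defensive.

Import Order.TTheory GRing.Theory Num.Theory.

Local Open Scope classical_set_scope.
Local Open Scope card_scope.
Local Open Scope ring_scope.

(** * Spanning trees of bipartite graphs *)

Section Graphs.
Variable T : finType.
Implicit Types (e le : rel T) (r : T) (f : T -> T) (A S W : {set T}).

(** A tree is given by its parent map [f].  The second clause expresses
    well-foundedness: were the iterates of [f] from some v to avoid [r], the
    set of these iterates would violate it. *)
Definition spanning_tree e r f :=
  (forall v, v != r -> e v (f v)) /\
  (forall W, W != finset.set0 -> exists2 v, v \in W & (v == r) || (f v \notin W)).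

(** The parent of a vertex is any neighbour closer to the root. *)
Lemma connected_spanning_tree e r :
  symmetric e -> (forall v, connect e r v) -> exists f, spanning_tree e r f.
Proof.
move=> esym conn.
have reach v : exists n, [exists p : n.-tuple T, path e r p && (last r p == v)].
  have /connectP[p ep ->] := conn v.
  by exists (size p); apply/existsP; exists (in_tuple p); rewrite ep eqxx.
pose dist v := ex_minn (reach v).
have closer v : v != r -> exists2 u, e v u & (dist u < dist v)%N.
  move=> vr; rewrite {2}/dist; case: ex_minnP => n /existsP[p /andP[ep /eqP lp]] _.
  case: p ep lp => s /= /eqP sn; elim/last_ind: s sn => [_ _ rv|s x _ sn].
    by rewrite -rv eqxx in vr.
  rewrite rcons_path last_rcons => /andP[es ex] xv; subst x.
  exists (last r s); first by rewrite esym.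
  rewrite /dist; case: ex_minnP => m _ mmin.
  rewrite -sn size_rcons ltnS; apply: mmin.
  by apply/existsP; exists (in_tuple s); rewrite es eqxx.
pose f v := odflt v [pick u | e v u && (dist u < dist v)%N].
have fP v : v != r -> e v (f v) && (dist (f v) < dist v)%N.
  move=> /closer[u evu du]; rewrite /f; case: pickP => //= /(_ u).
  by rewrite evu du.
exists f; split=> [v /fP/andP[]//|W /finset.set0Pn[w wW]].
case: (arg_minnP dist wW) => v vW vmin; exists v => //.
have [//|/fP/andP[_ dv]] := eqVneq v r.
by apply/negP => /vmin; rewrite leqNgt dv.
Qed.

(** A forest on [W] has fewer edges than vertices: sending an edge to its child
    endpoint misses some element of [W]. *)
Lemma tree_edges_lt e r f W : spanning_tree e r f -> W != finset.set0 ->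
  (#|[set v in W | (v != r) && (f v \in W)]%SET| < #|W|)%N.
Proof.
move=> [_ ft] /ft[v vW vP]; apply: proper_card; apply/properP; split.
  by apply/fintype.subsetP => u; rewrite inE => /andP[].
by exists v => //; rewrite inE vW; case/orP: vP => [->|/negPf->]; rewrite ?andbF.
Qed.

Definition crossing le S : rel T := fun a b =>
  [&& a \in S, b \notin S & le a b] || [&& b \in S, a \notin S & le b a].

Lemma crossing_sym le S : symmetric (crossing le S).
Proof. by move=> a b; rewrite /crossing orbC. Qed.

(** [S] is a minimal set having an element below every vertex.  It is an
    antichain, as an element above another one could be removed by
    transitivity.  A relation between two elements outside [S] is then bypassed
    through a common lower bound in [S]. *)
Lemma crossing_connected (le : rel T) :
  reflexive le -> transitive le ->
  (forall a b, connect (fun u v => le u v || le v u) a b) ->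
  exists S, (forall a b, connect (crossing le S) a b).
Proof.
move=> lexx letr conn.
pose dom (S : {set T}) := [forall v, [exists (s | s \in S), le s v]].
have domT : dom finset.setT.
  by apply/forallP => v; apply/existsP; exists v; rewrite inE lexx.
have [S /minsetP[/forallP domS Smin] _] := minset_exists domT.
have above v : exists2 s, s \in S & le s v.
  by have /existsP[s /andP[]] := domS v; exists s.
have anti s s' : s \in S -> s' \in S -> le s s' -> s = s'.
  move=> sS s'S ss'; apply: contraTeq isT => nss'.
  have : dom (S :\ s')%SET.
    apply/forallP => v; have [u uS uv] := above v; apply/existsP.
    have [us'|us'] := eqVneq u s'; last by exists u; rewrite !inE us' uS.
    by exists s; rewrite !inE nss' sS (letr u)// us'.
  move=> /Smin/(_ (finset.subD1set _ _)) E.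
  by move: s'S; rewrite -E !inE eqxx.
exists S => a b.
have csym := sym_connect_sym (crossing_sym le S).
have step u v : le u v -> connect (crossing le S) u v.
  have cr s t : s \in S -> t \notin S -> le s t -> connect (crossing le S) s t.
    by move=> sS tS st; apply: connect1; rewrite /crossing sS tS st.
  move=> uv; have [uS|uS] := boolP (u \in S).
    have [vS|vS] := boolP (v \in S); last exact: cr.
    by rewrite (anti u v).
  have [s sS su] := above u; have sv := letr _ _ _ su uv.
  have cus : connect (crossing le S) u s by rewrite csym; apply: cr.
  have [vS|vS] := boolP (v \in S); first by rewrite -(anti s v).
  by apply: connect_trans cus _; apply: cr.
apply: (connect_sub _ (conn a b)) => u v /orP[|]; first exact: step.
by move=> /step; rewrite csym.
Qed.

(** Children are taken outside [S] so that the count vanishes for [s] outside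
    [S], as it should for the parts of a composition indexed by [S]. *)
Definition branching f r S s : nat :=
  #|[set v | [&& v \notin S, v != r & f v == s]]%SET|.

Lemma branching_out le f r S s : spanning_tree (crossing le S) r f ->
  s \notin S -> branching f r S s = 0%N.
Proof.
move=> [fe _] sS; apply/eqP; rewrite cards_eq0 -finset.subset0.
apply/fintype.subsetP => v; rewrite !inE => /and3P[vS vr /eqP fv].
by move: (fe v vr); rewrite /crossing fv (negPf vS) (negPf sS).
Qed.

Lemma sum_branching f r S : r \notin S ->
  (\sum_s branching f r S s = #|T| - #|S| - 1)%N.
Proof.
move=> rS.
have -> : (\sum_s branching f r S s = #|(~: S) :\ r|%SET)%N.
  rewrite -sum1_card [RHS](partition_big f xpredT)//=; apply: eq_bigr => s _.
  rewrite /branching -sum1_card; apply: eq_bigl => v.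
  by rewrite !inE andbA [(_ \notin _) && _]andbC.
have := cardsD1 r (~: S)%SET; rewrite inE rS /= cardsCs finset.setCK => ->.
by rewrite addKn.
Qed.

(** As [A] avoids the root, each of its elements accounts for one edge to its
    parent and for the edges to its children; no edge is counted twice since
    the tree is bipartite. *)
Lemma edges_at_sources le f r S A : spanning_tree (crossing le S) r f ->
  r \notin S -> A \subset S ->
  #|[set v | (v != r) && ((v \in A) || (f v \in A))]%SET| =
  (#|A| + \sum_(s in A) branching f r S s)%N.
Proof.
move=> [fe _] rS /fintype.subsetP AS.
have -> : (\sum_(s in A) branching f r S s =
  #|[set v | [&& v \notin S, v != r & f v \in A]]%SET|)%N.
  rewrite -sum1_card [RHS](partition_big f (mem A))/=; last first.
    by move=> v; rewrite inE => /and3P[].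
  apply: eq_bigr => s sA; rewrite /branching -sum1_card; apply: eq_bigl => v.
  rewrite !inE -!andbA; do 2 congr (_ && _).
  by have [->|] := eqVneq; rewrite ?sA ?andbF.
rewrite -cardsUI [X in (_ + X)%N](_ : _ = 0)%N ?addn0; last first.
  apply/eqP; rewrite cards_eq0 -finset.subset0; apply/fintype.subsetP => v.
  by rewrite !inE => /andP[/AS->].
apply: eq_card => v; rewrite !inE.
have [->|vr] := eqVneq v r.
  by rewrite andbF orbF; apply/esym/negP => /AS; apply/negP.
have [//|vA /=] := boolP (v \in A).
have [fvA|] := boolP (f v \in A); rewrite ?andbF ?andbT//.
by move: (fe v vr); rewrite /crossing (AS _ fvA) andbF /= => /andP[->].
Qed.

(** The rigidity argument: comparing the two trees on the set [W] where [w] is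
    maximal, the edges at the sources in [W] number less than [#|W|] in the
    second tree and at least [#|W|] in the first one, unless [W] is
    everything. *)
Lemma branching_rigid (disp : Order.disp_t) (O : orderType disp) (w : T -> O)
    (le1 le2 : rel T) f1 f2 r1 r2 S :
  (forall s t, le1 s t -> (w t <= w s)%O) ->
  (forall s t, le2 s t -> (w s <= w t)%O) ->
  r1 \notin S -> r2 \notin S ->
  spanning_tree (crossing le1 S) r1 f1 ->
  spanning_tree (crossing le2 S) r2 f2 ->
  {in S, branching f1 r1 S =1 branching f2 r2 S} ->
  forall u v, w u = w v.
Proof.
move=> w1 w2 r1S r2S t1 t2 eb.
pose top := [arg max_(i > r1) w i]%O.
have topP u : (w u <= w top)%O.
  by rewrite /top; case: arg_maxP => // i _; apply.
suff const u : w u = w top by move=> u v; rewrite !const.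
pose W := [set v | w v == w top]%SET; pose A := (S :&: W)%SET.
have eqW v : (w v == w top) = (w top <= w v)%O by rewrite eq_le topP.
apply/eqP; apply: contraTT isT => uW.
have W0 : W != finset.set0 by apply/finset.set0Pn; exists top; rewrite inE.
have CW0 : (~: W)%SET != finset.set0.
  by apply/finset.set0Pn; exists u; rewrite !inE.
have AS : A \subset S by apply: finset.subsetIl.
have lt2 := tree_edges_lt t2 W0.
have lt1 := tree_edges_lt t1 CW0.
have e2 : (#|A| + \sum_(s in A) branching f2 r2 S s < #|W|)%N.
  rewrite -(edges_at_sources t2 r2S AS); apply: leq_ltn_trans lt2.
  apply: subset_leq_card; apply/fintype.subsetP => v.
  rewrite 2!inE => /andP[vr vA]; rewrite vr /=.
  have := t2.1 v vr; rewrite /crossing => /orP[] /and3P[xS yS xy]; move: vA.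
    rewrite !inE xS (negPf yS) orbF /= !eqW => vW.
    by rewrite vW (le_trans vW (w2 _ _ xy)).
  rewrite !inE xS (negPf yS) /= !eqW => vW.
  by rewrite vW (le_trans vW (w2 _ _ xy)).
have e1 : (#|W| <= #|A| + \sum_(s in A) branching f1 r1 S s)%N.
  rewrite -(edges_at_sources t1 r1S AS).
  set E := [set v | _]%SET.
  (* An edge of the first tree meeting both [W] and its complement has its
     source in [W]; so an edge not in [E] lies outside [W]. *)
  have : (#|T| <= (#|E| + #|[set v in ~: W | (v != r1) && (f1 v \in ~: W)]|).+1)%SET%N.
    rewrite -cardsT (cardsD1 r1) inE add1n ltnS.
    apply: leq_trans (leq_card_setU _ _); apply: subset_leq_card.
    apply/fintype.subsetP => v; rewrite !inE andbT => vr; rewrite vr /=.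
    have := t1.1 v vr; rewrite /crossing.
    by move=> /orP[] /and3P[xS yS /w1]; rewrite ?xS ?(negPf yS) /= ?orbF !eqW;
       case: (leP (w top)) => //= ylt yx; rewrite -ltNge (le_lt_trans yx).
  have := cardsC W. lia.
suff : (\sum_(s in A) branching f1 r1 S s = \sum_(s in A) branching f2 r2 S s)%N.
  lia.
by apply: eq_bigr => s; rewrite inE => /andP[sS _]; apply: eb.
Qed.
End Graphs.

(** * Counting codes *)

Section Codes.
Variable T : finType.

(** Weak compositions of [m] with parts indexed by [S].  The parts are stored
    in a type that depends neither on [S] nor on [m], so that compositions for
    different [S] can be gathered in one finite type. *)
Definition compositions (S : {set T}) (N m : nat) : {set {ffun T -> 'I_N.+1}} :=
  [set b : {ffun T -> 'I_N.+1} |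
    [forall (s | s \notin S), b s == 0%N :> nat] &&
    (\sum_s b s == m :> nat)%N]%SET.

Lemma card_compositions (S : {set T}) N m : (0 < #|S|)%N ->
  (#|compositions S N m| <= 'C(m + #|S| - 1, #|S| - 1))%N.
Proof.
case cS : #|S| => [//|p] _; rewrite addnS !subn1 addnC -card_ord_partitions.
pose el (i : 'I_p.+1) : T := enum_val (cast_ord (esym cS) i).
have sum_el (b : {ffun T -> 'I_N.+1}) : b \in compositions S N m ->
    (\sum_i (b (el i)) = m)%N.
  rewrite inE => /andP[/forall_inP b0 /eqP <-].
  rewrite [RHS](bigID (mem S))/= [X in (_ + X)%N]big1; last by move=> s /b0/eqP.
  rewrite addn0 [RHS]big_enum_val [RHS](reindex (cast_ord (esym cS)))//.
  by exists (cast_ord cS) => i _; rewrite ?cast_ordK ?cast_ordKV.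
pose F (b : {ffun T -> 'I_N.+1}) : p.+1.-tuple 'I_m.+1 :=
  [tuple inord (b (el i)) | i < p.+1].
have Fval b i : b \in compositions S N m -> tnth (F b) i = b (el i) :> nat.
  move=> /sum_el sb; rewrite tnth_mktuple inordK// ltnS -sb.
  by rewrite (bigD1 i)//= leq_addr.
have Finj : {in compositions S N m &, injective F}.
  move=> b b' bC b'C Fbb'; apply/ffunP => s; apply: val_inj => /=.
  have [sS|sS] := boolP (s \in S); last first.
    move: bC b'C; rewrite !inE => /andP[/forall_inP/(_ _ sS)/eqP-> _].
    by move=> /andP[/forall_inP/(_ _ sS)/eqP->].
  have -> : s = el (cast_ord cS (enum_rank_in sS s)).
    by rewrite /el cast_ordK enum_rankK_in.
  by rewrite -!Fval// Fbb'.
rewrite -(card_in_imset Finj); apply: subset_leq_card.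
apply/fintype.subsetP => _ /imsetP[b bC ->]; rewrite inE big_tuple.
by apply/eqP; rewrite -[RHS](sum_el b bC); apply: eq_bigr => i _; exact: Fval.
Qed.

Definition codes : {set {set T} * {ffun T -> 'I_#|T|.+1}} :=
  [set c : {set T} * {ffun T -> 'I_#|T|.+1} | (0 < #|c.1| < #|T|)%N &&
    (c.2 \in compositions c.1 #|T| (#|T| - #|c.1| - 1))]%SET.

Lemma card_codes :
  (#|codes| <= \sum_(1 <= p < #|T|) 'C(#|T| - 2, p - 1) * 'C(#|T|, p))%N.
Proof.
set n := #|T|.
have -> : #|codes| = (\sum_(S : {set T} | 0 < #|S| < n)
    \sum_(b in compositions S n (n - #|S| - 1)) 1)%N.
  by rewrite -sum1_card pair_big_dep /=; apply: eq_bigl => c; rewrite inE.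
apply: (@leq_trans (\sum_(S : {set T} | 0 < #|S| < n) 'C(n - 2, #|S| - 1))%N).
  apply: leq_sum => S /andP[S0 Sn]; rewrite sum1_card.
  apply: leq_trans (card_compositions _ _ S0) _.
  by rewrite (_ : n - #|S| - 1 + #|S| - 1 = n - 2)%N//; lia.
apply: eq_leq; under [RHS]eq_bigr => p _.
  rewrite -card_draws mulnC -sum_nat_const.
  under eq_bigl do rewrite inE.
  rewrite big_mkcond; over.
rewrite exchange_big/= big_mkcond; apply: eq_bigr => S _.
rewrite -big_mkcond /=; under eq_bigl do rewrite eq_sym.
by rewrite big_nat1_eq.
Qed.

End Codes.

(** * Extreme directions of cones *)

Section Dual_cone.
Context {R : realType} {d : nat}.
Implicit Types (x y z : 'cV[R]_d) (K F : set 'cV[R]_d).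

Lemma dotE x y : dot x y = \sum_i x i 0 * y i 0.
Proof. by rewrite /dot mxE; apply: eq_bigr => i _; rewrite mxE. Qed.

Lemma dotDr x y z : dot x (y + z) = dot x y + dot x z.
Proof. by rewrite /dot mulmxDr mxE. Qed.

Lemma dotZr k x y : dot x (k *: y) = k * dot x y.
Proof. by rewrite /dot -scalemxAr mxE. Qed.

Lemma dotC x y : dot x y = dot y x.
Proof. by rewrite !dotE; apply: eq_bigr => i _; rewrite mulrC. Qed.

Lemma dot_sumr (I : finType) x (F : I -> 'cV[R]_d) :
  dot x (\sum_i F i) = \sum_i dot x (F i).
Proof. by rewrite /dot mulmx_sumr summxE. Qed.

Lemma dot_unit_vec y i : dot y (unit_vec i) = y i 0.
Proof. by rewrite /dot /unit_vec -colE !mxE. Qed.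

Lemma dual_solvency_coneP (P : 'M[R]_d) y :
  dual_cone (solvency_cone P) y <-> forall i j, y j 0 <= P i j * y i 0.
Proof.
have gen i j : dot y (P i j *: unit_vec i - unit_vec j) = P i j * y i 0 - y j 0.
  by rewrite -scaleN1r dotDr !dotZr !dot_unit_vec mulN1r.
split=> [Ky i j|Hy x [z z0 ->]].
  rewrite -subr_ge0 -gen dotC; apply: Ky; exists (delta_mx i j) => [k l|].
    by rewrite mxE ler0n.
  rewrite (bigD1 i)//= (bigD1 j)//= !big1 ?addr0.
  - by rewrite mxE !eqxx scale1r.
  - by move=> k /negPf ki; rewrite big1// => l _; rewrite mxE ki scale0r.
  - by move=> l /negPf lj; rewrite mxE lj andbF scale0r.
rewrite dotC dot_sumr; apply: sumr_ge0 => i _.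
rewrite dot_sumr; apply: sumr_ge0 => j _.
by rewrite dotZr mulr_ge0// gen subr_ge0.
Qed.

(** A valid inequality that is tight at y is homogeneous, hence tight at 2y, and
    then tight at y + z because neither y + z nor y - z violates it.  So y and z
    are both parallel to the one-dimensional face of y. *)
Lemma extreme_direction_line K y z :
  (forall t x, 0 < t -> K x -> K (t *: x)) ->
  extreme_direction K y -> K (y + z) -> K (y - z) -> exists k, z = k *: y.
Proof.
move=> Kcone [Ky y0 [F [[a [c [ca FE]]] [x0 [U [dU hU]]] Fy]]] Kp Km.
have ay : dot a y = c by move: Fy; rewrite FE => -[].
have c0 : c = 0.
  have := ca _ (Kcone 2 _ ltac:(lra) Ky); have := ca _ (Kcone 2^-1 _ ltac:(lra) Ky).
  by rewrite !dotZr ay; lra.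
have az : dot a z = 0.
  move: (ca _ Kp) (ca _ Km); rewrite dotDr -scaleN1r dotDr dotZr ay c0; lra.
have inU x : F x -> x - x0 \in U.
  move=> Fx; have : affine_hull F x.
    exists 1%N, (fun=> x), (fun=> 1); split => //; first by rewrite big_ord1.
    by rewrite big_ord1 scale1r.
  by rewrite hU.
have diffU x x' : F x -> F x' -> x - x' \in U.
  move=> /inU xU /inU x'U; have -> : x - x' = (x - x0) - (x' - x0).
      by rewrite opprB addrA subrK.
    exact: memvB.
have F2 : F (2 *: y).
  by rewrite FE; split; [apply: Kcone => //; lra|rewrite dotZr ay c0 mulr0].
have Fp : F (y + z) by rewrite FE; split => //; rewrite dotDr ay az addr0.
have yU : y \in U.
  by have := diffU _ _ F2 Fy; rewrite scaler_nat mulr2n addrK.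
have zU : z \in U by have := diffU _ _ Fp Fy; rewrite addrC addKr.
apply/vlineP; suff -> : (<[y]> = U)%VS by [].
by apply/eqP; rewrite eqEdim -memvE yU dU dim_vline y0.
Qed.

End Dual_cone.

(** * The dual of the solvency cone *)

Section Solvency.
Context {R : realType} {d : nat}.
Variable P : 'M[R]_d.
Hypotheses (P_diag : forall i, P i i = 1) (P_pos : forall i j, 0 < P i j)
  (P_tri : forall i j k, P i j <= P i k * P k j)
  (P_strict : exists i j k, P i j < P i k * P k j).
Implicit Types y : 'cV[R]_d.
Local Notation K := (dual_cone (solvency_cone P)).

(** If every product P_ij P_ji were 1, triangle inequalities would all be
    equalities.  A product larger than 1 gives a nonnegative coordinate y_i, which
    bounds all the others from below; and one vanishing coordinate would bound
    all the others by 0. *)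
Lemma dual_solvency_cone_gt0 y : K y -> y != 0 -> forall i, 0 < y i 0.
Proof.
move=> /dual_solvency_coneP Ky y0.
have [i [j Pij]] : exists i j, 1 < P i j * P j i.
  apply: contrapT => no; have [i [j [k]]] := P_strict.
  have inv u v : P u v * P v u = 1.
    apply/eqP; rewrite eq_le -{2}(P_diag u) P_tri andbT leNgt.
    by apply/negP => uv; apply: no; exists u, v.
  suff -> : P i k * P k j = P i j * (P i k * P k j * P j i).
    rewrite ltNge => /negP; apply; rewrite ler_piMr ?(ltW (P_pos _ _))//.
    rewrite -[leRHS](mulr1 1) -{1}(inv i k) -(inv k j).
    rewrite mulrACA ler_wpM2l ?mulr_ge0 ?(ltW (P_pos _ _))//.
    by rewrite mulrC.
  by rewrite [P i k * _ * _]mulrC mulrA inv mul1r.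
have yi : 0 <= y i 0.
  have le1 := Ky j i; have := ler_wpM2l (ltW (P_pos j i)) (Ky i j).
  move=> /(le_trans le1); rewrite mulrA [P j i * _]mulrC => le2.
  rewrite leNgt; apply/negP => yi0; move: le2.
  by rewrite -[leLHS]mul1r ler_nM2r// leNgt Pij.
have yge0 k : 0 <= y k 0.
  by have := le_trans yi (Ky k i); rewrite pmulr_rge0.
move=> k; rewrite lt_neqAle yge0 andbT eq_sym; apply: contra y0 => /eqP yk.
apply/eqP/colP => l; rewrite mxE; apply/eqP; rewrite eq_le yge0 andbT.
by have := Ky k l; rewrite yk mulr0.
Qed.

Definition tight y : rel 'I_d := fun i j => P i j * y i 0 == y j 0.

Lemma tight_refl y : reflexive (tight y).
Proof. by move=> i; rewrite /tight P_diag mul1r. Qed.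

Lemma tight_trans y : K y -> (forall i, 0 < y i 0) -> transitive (tight y).
Proof.
move=> /dual_solvency_coneP Ky ygt0 k i j /eqP ik /eqP kj.
rewrite /tight eq_le Ky andbT -kj -ik mulrA [P k j * _]mulrC.
by rewrite ler_pM2r.
Qed.

(** Multiplying the coordinates of one component by 1 + s eps preserves the
    tight pairs, and the other inequalities when eps is small.  Hence this
    perturbation is proportional to y, so the component is everything. *)
Lemma tight_connected y : extreme_direction K y -> (forall i, 0 < y i 0) ->
  forall a b, connect (fun u v => tight y u v || tight y v u) a b.
Proof.
move=> ext ygt0 a b; set e := (X in connect X).
have esym : symmetric e by move=> u v; rewrite /e orbC.
have Ky : forall i j, y j 0 <= P i j * y i 0.
  by apply/dual_solvency_coneP; case: ext.
(* With A = P_ij y_i > B = y_j, the inequality (1 - eps) A >= (1 + eps) B amounts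
   to eps <= (A - B) / (A + B). *)
pose slack i j := if tight y i j then 1
  else (P i j * y i 0 - y j 0) / (P i j * y i 0 + y j 0).
have sum_gt0 i j : 0 < P i j * y i 0 + y j 0 by rewrite addr_gt0 ?mulr_gt0.
have slack_gt0 i j : 0 < slack i j.
  rewrite /slack; case: ifPn => // nt; rewrite divr_gt0// subr_gt0.
  by rewrite lt_neqAle Ky andbT eq_sym.
pose eps := \big[Order.min/1]_(p : 'I_d * 'I_d) slack p.1 p.2.
have eps_gt0 : 0 < eps by apply: lt_bigmin.
have eps_le1 : eps <= 1 by apply: bigmin_le_id.
have eps_slack i j : ~~ tight y i j ->
    eps * (P i j * y i 0 + y j 0) <= P i j * y i 0 - y j 0.
  move=> /negPf nt; rewrite -ler_pdivlMr//.
  by have := bigmin_le 1 (i, j) (fun p => slack p.1 p.2); rewrite /slack /= nt.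
pose z : 'cV[R]_d := \col_i ((connect e a i)%:R * (eps * y i 0)).
have pert s : -1 <= s <= 1 -> K (y + s *: z).
  move=> s1; apply/dual_solvency_coneP => i j; rewrite !mxE.
  set ci := connect e a i; set cj := connect e a j.
  have [t|nt] := boolP (tight y i j).
    have -> : cj = ci.
      have ij : connect e i j by apply: connect1; rewrite /e t.
      by rewrite /cj -(same_connect_r (sym_connect_sym esym) ij).
    by rewrite -(eqP t) le_eqVlt; apply/orP; left; apply/eqP; ring.
  have nonneg (c : bool) : -eps <= s * (c%:R * eps) <= eps.
    by case: c; rewrite ?mul0r ?mulr0 ?mul1r; nra.
  have /andP[li _] := nonneg ci; have /andP[_ uj] := nonneg cj.
  have := eps_slack _ _ nt.
  have := ygt0 j; have : 0 < P i j * y i 0 by rewrite mulr_gt0.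
  move=> A0 B0 sl.
  have -> : P i j * (y i 0 + s * (ci%:R * (eps * y i 0))) =
    (P i j * y i 0) * (1 + s * (ci%:R * eps)) by ring.
  have -> : y j 0 + s * (cj%:R * (eps * y j 0)) = y j 0 * (1 + s * (cj%:R * eps)).
    by ring.
  nra.
have Kcone t x : 0 < t -> K x -> K (t *: x).
  move=> t0 /dual_solvency_coneP Kx; apply/dual_solvency_coneP => i j.
  by rewrite !mxE mulrCA ler_pM2l.
have [k zk] : exists k, z = k *: y.
  apply: (extreme_direction_line Kcone ext).
    by rewrite -[z]scale1r; apply: pert; lra.
  by rewrite -scaleN1r; apply: pert; lra.
have zE i : (connect e a i)%:R * eps = k.
  have /matrixP/(_ i 0) := zk; rewrite !mxE mulrA.
  by apply: mulIf; rewrite gt_eqF.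
have := zE b; rewrite -(zE a) connect0 mul1r.
by case: connect => //; rewrite mul0r => /eqP; rewrite lt_eqF.
Qed.

(** The root and the tree are left unspecified: any choice yields a code that
    determines the ray of [y]. *)
Definition encodes y (c : {set 'I_d} * {ffun 'I_d -> 'I_#|'I_d|.+1}) :=
  exists r f, [/\ r \notin c.1, spanning_tree (crossing (tight y) c.1) r f
    & forall s, c.2 s = branching f r c.1 s :> nat].

Lemma encodes_exists y : (2 <= d)%N -> extreme_direction K y ->
  exists2 c, c \in codes 'I_d & encodes y c.
Proof.
move=> d2 ext; have [Ky y0 _] := ext.
have ygt0 := dual_solvency_cone_gt0 Ky y0.
have [S conn] := crossing_connected (tight_refl y) (tight_trans Ky ygt0)
  (tight_connected ext ygt0).
have crs := crossing_sym (tight y) S.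
have nontriv (u v : 'I_d) : u != v -> exists w w', crossing (tight y) S w w'.
  move=> uv; have /connectP[[|w p] /=] := conn u v.
    by move=> _ uv'; rewrite uv' eqxx in uv.
  by move=> /andP[uw _] _; exists u, w.
have [s [r [sS rS]]] : exists s r, s \in S /\ r \notin S.
  have [w [w']] := nontriv (Ordinal (ltnW d2)) (Ordinal d2) isT.
  by rewrite /crossing => /orP[] /and3P[? ? _]; [exists w, w'|exists w', w].
have [f ft] := connected_spanning_tree crs (conn r).
have bN s' : (branching f r S s' < #|'I_d|.+1)%N by rewrite ltnS max_card.
exists (S, [ffun s' => Ordinal (bN s')]); last first.
  by exists r, f; split=> // s'; rewrite ffunE.
rewrite !inE /=; apply/and3P; split.
- apply/andP; split; first by apply/card_gt0P; exists s.
  by rewrite -cardsT proper_card// properE finset.subsetT; apply/subsetPn; exists r.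
- by apply/forall_inP => t tS; rewrite ffunE /= (branching_out ft tS).
- by under eq_bigr do rewrite ffunE /=; rewrite sum_branching.
Qed.

(** The ratio y'/y does not increase along the tight pairs of y and does not
    decrease along those of y', so [branching_rigid] makes it constant. *)
Lemma encodes_inj y y' c : K y -> K y' ->
  (forall i, 0 < y i 0) -> (forall i, 0 < y' i 0) ->
  encodes y c -> encodes y' c -> exists2 k, 0 < k & y' = k *: y.
Proof.
move=> /dual_solvency_coneP Ky /dual_solvency_coneP Ky' y0 y'0.
move=> [r [f [rS ft cb]]] [r' [f' [r'S f't c'b]]].
pose w i := y' i 0 / y i 0.
have w1 s t : tight y s t -> (w t <= w s)%O.
  move=> /eqP st; rewrite /w ler_pdivrMr// -st.
  by rewrite mulrCA divfK ?gt_eqF.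
have w2 s t : tight y' s t -> (w s <= w t)%O.
  move=> /eqP st; rewrite /w ler_pdivlMr// -st mulrAC ler_pdivrMr//.
  by rewrite -mulrA mulrCA ler_pM2l.
have const := branching_rigid w1 w2 rS r'S ft f't.
exists (w r); first exact: divr_gt0.
apply/colP => i; rewrite !mxE (const _ r i) ?divfK ?gt_eqF// => s _.
by rewrite -cb -c'b.
Qed.

End Solvency.

(** * The bound *)

Lemma open_ray_scale (R : realType) d (y : 'cV[R]_d) k :
  0 < k -> open_ray (k *: y) = open_ray y.
Proof.
move=> k0; apply/seteqP; split=> _ [t /= t0 <-].
  by exists (t * k); rewrite /= ?mulr_gt0 ?scalerA.
by exists (t / k); rewrite /= ?divr_gt0// scalerA divfK ?gt_eqF.
Qed.

Theorem corollary13 (R : realType) (d : nat) (hd : (2 <= d)%N) (P : 'M[R]_d)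
  (P_diag : forall i, P i i = 1)
  (P_pos : forall i j, 0 < P i j)
  (P_tri : forall i j k, P i j <= P i k * P k j)
  (P_strict : exists i j k, P i j < P i k * P k j) :
  extreme_rays (dual_cone (solvency_cone P))
    #<= `I_(\sum_(1 <= p < d) 'C(d - 2, p - 1) * 'C(d, p))%N.
Proof.
set K := dual_cone _.
have [g gP] : {g & forall X, extreme_rays K X -> exists y,
    [/\ extreme_direction K y, X = open_ray y, g X \in codes 'I_d
      & encodes P y (g X)]}.
  apply: (choice (P := fun X c => extreme_rays K X -> exists y, [/\ extreme_direction K y,
    X = open_ray y, c \in codes 'I_d & encodes P y c])) => X.
  have [[y ext <-]|noX] := pselect (extreme_rays K X).
    have [c cC yc] := encodes_exists P_diag P_pos P_tri P_strict hd ext.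
    by exists c => _; exists y.
  by exists (finset.set0, [ffun=> ord0]).
have ginj : {in extreme_rays K &, injective g}.
  move=> X X' /set_mem/gP[y [ext -> _ yc]] /set_mem/gP[y' [ext' -> _ y'c]] gXX'.
  have [Ky y0 _] := ext; have [Ky' y'0 _] := ext'.
  rewrite -gXX' in y'c.
  have gt0 := dual_solvency_cone_gt0 P_diag P_pos P_tri P_strict.
  have [k k0 ->] := encodes_inj Ky Ky' (gt0 _ Ky y0) (gt0 _ Ky' y'0) yc y'c.
  by rewrite open_ray_scale.
(* Numbering the codes turns [g] into an injection into an initial segment. *)
pose h X := index (g X) (enum (codes 'I_d)).
have hinj : {in extreme_rays K &, injective h}.
  move=> X X' XK X'K hXX'; apply: ginj => //.
  have [_ [_ _ gC _]] := gP X (set_mem XK).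
  have [_ [_ _ gC' _]] := gP X' (set_mem X'K).
  rewrite -[LHS](nth_index (g X) (s := enum (codes 'I_d))) ?mem_enum//.
  by rewrite -/(h X) hXX' nth_index ?mem_enum.
rewrite -(card_le_eql (inj_card_eq hinj)); apply: subset_card_le => _ [X XK <-] /=.
have [_ [_ _ gC _]] := gP X XK.
have hX : (h X < #|codes 'I_d|)%N by rewrite cardE index_mem mem_enum.
by have := leq_trans hX (card_codes 'I_d); move: (h X) => k; rewrite card_ord.
Qed.
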